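(* For $n\in\mathbb{N}$ let $m=\lfloor\sqrt n\rfloor$ and $G_n=\{1,\dots,m\}\times\{1,\dots,m\}\subset\mathbb{R}^2$. Let $M(n)$ be the maximum, over all $p>0$, of the number of non-degenerate triangles with vertices in $G_n$ and perimeter $p$. Then $M(n)=O\big(n^{3/2+O(1/\log\log n)}\big)$ and $M(n)=\Omega(n^{5/4})$; that is, there are constants $C,C',c>0$ such that $M(n)\le C\,n^{3/2+C'/\log\log n}$ for all sufficiently large $n$, and $M(n)\ge c\,n^{5/4}$ for all sufficiently large $n$.
   Context: A triangle is non-degenerate if its three vertices are not collinear; its perimeter is the sum of its three Euclidean side lengths. *)

(* Defs.v *)
From mathcomp Require Import all_boot all_order all_algebra.
From mathcomp Require Import finmap.
From mathcomp Require Import all_classical all_reals all_analysis.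

Set Implicit Arguments.
Unset Strict Implicit.
Unset Printing Implicit Defensive.

Import Order.TTheory GRing.Theory Num.Theory.

Local Open Scope ring_scope.

Section Triangles.
Variable R : realType.
Implicit Types (a b c q : R * R) (p : R) (T : {fset R * R}) (n : nat).

(* The canonical norm on the product R * R is the sup norm, hence the explicit
   Euclidean formula. *)
Definition euclidean_dist a b : R :=
  Num.sqrt ((a.1 - b.1) ^+ 2 + (a.2 - b.2) ^+ 2).

Definition collinear a b c : Prop :=
  exists u v w : R, (u != 0) || (v != 0) /\
    forall q, q \in [fset a; b; c]%fset -> u * q.1 + v * q.2 = w.

(* A triangle is identified with its (unordered) set of vertices.
   Non-collinearity forces a, b, c to be pairwise distinct, so that T has
   exactly three elements and its perimeter does not depend on the choice of
   the enumeration a, b, c. *)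
Definition nondeg_triangle_of_perimeter p T : Prop :=
  exists a b c, [/\ T = [fset a; b; c]%fset, ~ collinear a b c &
    euclidean_dist a b + euclidean_dist b c + euclidean_dist c a = p].

Definition grid_side n : nat := Num.truncn (Num.sqrt (n%:R : R)).

Definition grid n : {fset R * R} :=
  [fset (i%:R, j%:R) | i in iota 1 (grid_side n),
                       j in iota 1 (grid_side n)]%fset.

Definition triangle_count n p : nat :=
  #|` [fset T in fpowerset (grid n) | `[< nondeg_triangle_of_perimeter p T >]]%fset|.

Definition attained_count n : pred nat :=
  fun k => `[< exists2 p, 0 < p & triangle_count n p = k >].

Lemma attained_count_ex n : exists k, attained_count n k.
Proof. by exists (triangle_count n 1); apply/asboolP; exists 1. Qed.

Lemma attained_count_le n k :
  attained_count n k -> (k <= #|` fpowerset (grid n)|)%N.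
Proof.
move=> /asboolP[p _ <-]; apply: fsubset_leq_card.
by apply/fsubsetP => T; rewrite !inE => /andP[].
Qed.

Definition max_triangles n : nat :=
  ex_maxn (attained_count_ex n) (@attained_count_le n).

End Triangles.

(* Main.v *)
(* Upper bound. Fix p. Comparing square roots modulo squares, every side of a
   triangle of perimeter p lies in the square class of one of the sides of a
   fixed such triangle, so the squared side lengths take O(m) values. Choose a
   vertex a (m^2 ways), the squared length of a side ab, the vector b - a (a
   representation as a sum of two squares), and finally c, which lies on an
   ellipse with foci a and b. The number of lattice points on that ellipse, when
   not trivially bounded, is a number of representations X^2 + D Y^2 = N with N
   polynomial in n, hence at most 20 tau(N)^2, and tau(N) = n^(O(1/ln ln n)).

   Lower bound. For 1 <= i < r the isosceles triangle with base 2 (r^2 - i^2) and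
   height 2 r i has perimeter 4 r^2. With r ~ m^(1/2) / 2 there are about m^(1/2)
   such triangles, each with about m^2 translates in the grid. *)
Require Import Defs.
From mathcomp Require Import all_boot all_order all_algebra.
From mathcomp Require Import finmap.
From mathcomp Require Import all_classical all_reals all_analysis.
From mathcomp Require Import zify ring lra.

Set Implicit Arguments.
Unset Strict Implicit.
Unset Printing Implicit Defensive.

Import Order.TTheory GRing.Theory Num.Theory.
Import numFieldNormedType.Exports.

Local Open Scope classical_set_scope.
Local Open Scope ring_scope.

(** * Cardinality bounds for arbitrary predicates *)

(** Testing duplicate-free sequences expresses [#{x | P x} <= B] for a predicate whose finiteness is
    itself part of the claim. *)
Definition at_most (T : eqType) (P : T -> Prop) (B : nat) : Prop :=
  forall s : seq T, uniq s -> (forall x, x \in s -> P x) -> (size s <= B)%N.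

Lemma at_most_sub (T : eqType) (P Q : T -> Prop) A B :
  at_most Q A -> (forall x, P x -> Q x) -> (A <= B)%N -> at_most P B.
Proof.
move=> QA PQ AB s us sP; apply: leq_trans AB; apply: QA => // x xs.
exact/PQ/sP.
Qed.

Lemma at_most_le (T : eqType) (P : T -> Prop) A B :
  (A <= B)%N -> at_most P A -> at_most P B.
Proof. by move=> AB PA; apply: (at_most_sub PA). Qed.

(** Lets a count be made relative to a solution assumed known: without any solution the count is
    0. *)
Lemma at_most_base (T : eqType) (P : T -> Prop) B :
  (forall x, P x -> at_most P B) -> at_most P B.
Proof.
by move=> PB [|x s] us sP //; apply: (PB x) => //; apply: sP; rewrite mem_head.
Qed.

Lemma at_most_mem (T : eqType) (r : seq T) : at_most (fun x => x \in r) (size r).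
Proof. by move=> s us sr; apply: uniq_leq_size. Qed.

Lemma at_most1 (T : eqType) (P : T -> Prop) :
  (forall x y, P x -> P y -> x = y) -> at_most P 1.
Proof.
move=> Pxy [|x [|y s]] //= /andP[/negP xs _] sP; case: xs.
have -> : x = y by apply: Pxy; apply: sP; rewrite !inE eqxx ?orbT.
by rewrite mem_head.
Qed.

Lemma at_most_fiber (T K : eqType) (P : T -> Prop) (Q : K -> Prop)
    (f : T -> K) A B :
  at_most Q A -> (forall x, P x -> Q (f x)) ->
  (forall k, at_most (fun x => P x /\ f x = k) B) -> at_most P (A * B).
Proof.
move=> QA PQ PB s us sP.
(* Induction on a list [ks] covering the values of [f]: the fibre over the head is split off. *)
have main ks r : uniq r -> {subset r <= s} -> {subset map f r <= ks} ->
    (size r <= size ks * B)%N.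
  elim: ks r => [|k ks IH] r ur rs rks.
    by case: r ur rs rks => // x r _ _ /(_ (f x)); rewrite mem_head => /(_ isT).
  rewrite mulSn -(count_predC (fun x => f x == k) r) -!size_filter leq_add //.
    apply: (PB k); first exact: filter_uniq.
    by move=> x; rewrite mem_filter => /andP[/eqP fx xr]; split=> //; exact/sP/rs.
  apply: IH; first exact: filter_uniq.
    by move=> x; rewrite mem_filter => /andP[_]; exact: rs.
  move=> _ /mapP[x + ->]; rewrite mem_filter /= => /andP[fxk xr].
  by have := rks (f x) (map_f f xr); rewrite inE (negbTE fxk).
apply: leq_trans (main (undup (map f s)) s us _ _) _ => //.
  by move=> y; rewrite mem_undup.
rewrite leq_mul2r; apply/orP; right; apply: QA; first exact: undup_uniq.
by move=> y; rewrite mem_undup => /mapP[x xs ->]; exact/PQ/sP.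
Qed.

Lemma at_most_inj (T K : eqType) (P : T -> Prop) (Q : K -> Prop)
    (f : T -> K) A :
  at_most Q A -> (forall x, P x -> Q (f x)) ->
  (forall x y, P x -> P y -> f x = f y -> x = y) -> at_most P A.
Proof.
move=> QA PQ fI; rewrite -(muln1 A); apply: (at_most_fiber QA PQ) => k.
by apply: at_most1 => x y [Px <-] [Py /esym]; exact: fI.
Qed.

Lemma at_most_image (T K : eqType) (P : T -> Prop) (Q : K -> Prop)
    (g : K -> T) A :
  at_most Q A -> (forall x, P x -> exists2 k, Q k & g k = x) -> at_most P A.
Proof.
move=> QA PQ s us sP.
have [ks ksg ksQ] : exists2 ks, map g ks = s & forall k, k \in ks -> Q k.
  elim: s sP {us} => [|x s IH] sP; first by exists [::].
  have [|ks <- ksQ] := IH; first by move=> y ys; apply: sP; rewrite inE ys orbT.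
  have [k Qk gk] := PQ x (sP x (mem_head _ _)).
  exists (k :: ks); first by rewrite /= gk.
  by move=> j; rewrite inE => /orP[/eqP ->|/ksQ].
rewrite -ksg size_map; apply: QA => //.
by apply: (@map_uniq _ _ g); rewrite ksg.
Qed.

Lemma at_most_or (T : eqType) (P Q : T -> Prop) A B :
  at_most P A -> at_most Q B -> at_most (fun x => P x \/ Q x) (A + B).
Proof.
move=> PA QB s us sPQ; rewrite -(count_predC (fun x => `[< P x >]) s) -!size_filter.
rewrite leq_add //; [apply: PA|apply: QB]; rewrite ?filter_uniq //.
  by move=> x; rewrite mem_filter => /andP[/asboolP].
move=> x; rewrite mem_filter /= => /andP[/asboolP nPx /sPQ[] //].
Qed.

Lemma at_most_pair (T K : eqType) (P : T -> Prop) (Q : K -> Prop) A B :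
  at_most P A -> at_most Q B ->
  at_most (fun x : T * K => P x.1 /\ Q x.2) (A * B).
Proof.
move=> PA QB; apply: (@at_most_fiber _ _ _ P fst) => // [x []//|k].
apply: (@at_most_inj _ _ _ Q snd) => // [x [[]]//|[a b] [c d]] /=.
by move=> [_ ->] [_ ->] ->.
Qed.

Lemma at_most_leq m : at_most (fun i : nat => (i <= m)%N) m.+1.
Proof.
rewrite -[m.+1](size_iota 0); apply: (at_most_sub (@at_most_mem _ _)) => // i.
by rewrite mem_iota.
Qed.

Lemma at_most_bool (A : bool -> Prop) : at_most A 2.
Proof. by apply: (at_most_sub (@at_most_mem _ [:: true; false])) => // -[]. Qed.

(** * Divisors and representations by [X^2 + D Y^2] *)

Definition tau (N : nat) : nat := size (divisors N).

Lemma at_most_dvdn N : (0 < N)%N -> at_most (fun d => d %| N)%N (tau N).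
Proof.
move=> N0; apply: (at_most_sub (@at_most_mem _ (divisors N))) => // d.
by rewrite dvdn_divisors.
Qed.

Lemma dvd_tau_le M N : (0 < N)%N -> (M %| N)%N -> (tau M <= tau N)%N.
Proof.
move=> N0 MN; have M0 := dvdn_gt0 N0 MN.
apply: (at_most_dvdn N0); first exact: divisors_uniq.
by move=> d; rewrite -dvdn_divisors // => /dvdn_trans ->.
Qed.

(** Brahmagupta's identity writes [N^2] as a square plus [D * (w * y' - w' * y)^2]. With
    [k^2 <= 4 * D] this leaves [j^2 <= 4]. *)
Lemma rep_coprime_cross (D N k j w y w' y' : int) :
  0 < D -> 0 < N -> 0 < k -> k ^+ 2 <= 4 * D ->
  w ^+ 2 + D * y ^+ 2 = N -> w' ^+ 2 + D * y' ^+ 2 = N ->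
  k * (w * y' - w' * y) = N * j -> -2 <= j <= 2.
Proof.
move=> D0 N0 k0 kD E E' kj.
have : D * N ^+ 2 * j ^+ 2 <= D * N ^+ 2 * 4.
  have -> : D * N ^+ 2 * j ^+ 2 = k ^+ 2 * (D * (w * y' - w' * y) ^+ 2).
    by rewrite -mulrA -exprMn -kj; ring.
  apply: (@le_trans _ _ (k ^+ 2 * N ^+ 2)).
    apply: ler_wpM2l; first exact: sqr_ge0.
    have -> : N ^+ 2 = (w * w' + D * (y * y')) ^+ 2 + D * (w * y' - w' * y) ^+ 2.
      by rewrite expr2 -{1}E -E'; ring.
    by rewrite lerDr sqr_ge0.
  rewrite [leRHS](_ : _ = 4 * D * N ^+ 2); last by ring.
  by apply: ler_wpM2r => //; exact: sqr_ge0.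
rewrite ler_pM2l ?mulr_gt0 ?exprn_gt0 // => j4.
by apply/andP; nia.
Qed.

(* In Z[sqrt (- D)], the hypothesis equates the imaginary parts of the products
   with the conjugate of w + y sqrt (- D); the norms then equate the real parts. *)
Lemma rep_determined (D N w y w1 y1 w2 y2 : int) :
  0 < D -> 0 < N -> 0 <= w -> 0 <= y -> 0 <= w1 -> 0 <= y1 -> 0 <= w2 -> 0 <= y2 ->
  w ^+ 2 + D * y ^+ 2 = N -> w1 ^+ 2 + D * y1 ^+ 2 = N ->
  w2 ^+ 2 + D * y2 ^+ 2 = N ->
  w1 * y - w * y1 = w2 * y - w * y2 -> w1 = w2 /\ y1 = y2.
Proof.
move=> D0 N0 w0 y0 w10 y10 w20 y20 E E1 E2 EC.
(* Both sides are nonnegative, so it suffices to compare their squares. *)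
have P : w1 * w + D * (y1 * y) = w2 * w + D * (y2 * y).
  apply/eqP; rewrite -(@eqrXn2 _ 2) ?addr_ge0 ?mulr_ge0 ?(ltW D0) //; apply/eqP.
  have e1 : (w1 * w + D * (y1 * y)) ^+ 2 + D * (w1 * y - w * y1) ^+ 2 = N ^+ 2.
    by rewrite [N ^+ 2]expr2 -{1}E -E1; ring.
  have e2 : (w2 * w + D * (y2 * y)) ^+ 2 + D * (w2 * y - w * y2) ^+ 2 = N ^+ 2.
    by rewrite [N ^+ 2]expr2 -{1}E -E2; ring.
  by move: e1; rewrite -e2 EC => /addIr.
have N1 (a b : int) : a * N = b * N -> a = b by apply: mulIf; rewrite gt_eqF.
(* Multiplying back by [w + y sqrt (- D)] recovers [N * w1] and [N * y1] from the real and imaginary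
   parts. *)
split; apply: N1; rewrite -E.
  rewrite (_ : _ * _ = w * (w1 * w + D * (y1 * y)) + D * y * (w1 * y - w * y1)).
    by rewrite P EC; ring.
  by ring.
rewrite (_ : _ * _ = y * (w1 * w + D * (y1 * y)) - w * (w1 * y - w * y1)).
  by rewrite P EC; ring.
by ring.
Qed.

Lemma dvdz_gcd_mul (N a b c : int) :
  (N %| a * c)%Z -> (N %| b * c)%Z -> (N %| gcdz a b * c)%Z.
Proof.
move=> Na Nb; suff : (N %| gcdz a b * `|c|%:Z)%Z by rewrite !dvdzE !abszM absz_id.
by rewrite mulz_gcdl dvdz_gcd Na Nb.
Qed.

Lemma dvdz_exp2 (d m : int) : (d %| m)%Z -> (d ^+ 2 %| m ^+ 2)%Z.
Proof. by move=> /dvdzP[q ->]; rewrite exprMn dvdz_mull. Qed.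

Lemma gcdz_gt0l (a b : int) : 0 < a -> 0 < gcdz a b.
Proof. by move=> a0; rewrite lt_neqAle eq_sym gcdz_eq0 (gt_eqF a0). Qed.

Lemma rep_coprimez (D N w y : int) :
  w ^+ 2 + D * y ^+ 2 = N -> coprimez w y -> coprimez N y.
Proof.
move=> <- wy; rewrite /coprimez gcdzC addrC (expr2 y) mulrA gcdzMDl -/(coprimez _ _).
by rewrite coprimez_sym; exact: coprimezXl.
Qed.

(* With h = gcd(N, w y0 - w0 y), N/h divides w y0 + w0 y, and the common
   factor k of h and N/h is controlled by D alone. *)
Lemma rep_class_cross (D N w y w1 y1 w0 y0 h : int) :
  0 < D -> 0 < N ->
  w ^+ 2 + D * y ^+ 2 = N -> w1 ^+ 2 + D * y1 ^+ 2 = N ->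
  w0 ^+ 2 + D * y0 ^+ 2 = N ->
  coprimez w y -> coprimez w0 y0 ->
  gcdz N (w * y0 - w0 * y) = h -> gcdz N (w1 * y0 - w0 * y1) = h ->
  exists2 k : int, k = gcdz h (N %/ h)%Z &
  [/\ 0 < k, k ^+ 2 <= 4 * D & (N %| k * (w * y1 - w1 * y))%Z].
Proof.
move=> D0 N0 E E1 E0 cwy cwy0 Eh Eh1; exists (gcdz h (N %/ h)%Z) => //.
have h0 : 0 < h by rewrite -Eh gcdz_gt0l.
have hN : (h %| N)%Z by rewrite -Eh dvdz_gcdl.
set H := (N %/ h)%Z; have hHN : h * H = N by rewrite mulrC divzK.
have H0 : 0 < H by rewrite -(pmulr_rgt0 _ h0) hHN.
(* [N] divides the product of [v * y0 - w0 * z] and [v * y0 + w0 * z], hence [h] times the second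
   factor. *)
have sumH v z : v ^+ 2 + D * z ^+ 2 = N -> gcdz N (v * y0 - w0 * z) = h ->
    (H %| v * y0 + w0 * z)%Z.
  move=> Ev Ehv; rewrite -(@dvdz_mul2l h) ?gt_eqF // hHN -Ehv.
  apply: dvdz_gcd_mul; first exact: dvdz_mulr.
  have -> : (v * y0 - w0 * z) * (v * y0 + w0 * z) = N * (y0 ^+ 2 - z ^+ 2).
    by rewrite mulrBr -{1}Ev -E0; ring.
  exact: dvdz_mulr.
have difh v z : gcdz N (v * y0 - w0 * z) = h -> (h %| v * y0 - w0 * z)%Z.
  by move=> <-; exact: dvdz_gcdr.
have cNy0 := rep_coprimez E0 cwy0.
have cNy := rep_coprimez E cwy.
(* [y0] is coprime to [N], so divisibility may be tested on [y0 * (w * y1 - w1 * y)], a combination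
   of the two differences. *)
have hC : (h %| w * y1 - w1 * y)%Z.
  rewrite -(@Gauss_dvdzr _ y0); last first.
    by rewrite coprimez_sym; apply: coprimez_dvdr hN _; rewrite coprimez_sym.
  rewrite (_ : _ * _ = y1 * (w * y0 - w0 * y) - y * (w1 * y0 - w0 * y1)); last by ring.
  by rewrite rpredB // dvdz_mull // difh.
have HN : (H %| N)%Z by rewrite -hHN dvdz_mull.
have HC : (H %| w * y1 - w1 * y)%Z.
  rewrite -(@Gauss_dvdzr _ y0); last first.
    by rewrite coprimez_sym; apply: coprimez_dvdr HN _; rewrite coprimez_sym.
  rewrite (_ : _ * _ = y1 * (w * y0 + w0 * y) - y * (w1 * y0 + w0 * y1)); last by ring.
  by rewrite rpredB // dvdz_mull // sumH.
have k0 := gcdz_gt0l H h0.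
split => //; last first.
  (* Both [h] and [H] divide the cross term, so [N = h * H] divides its products with [h] and with
     [H], hence with their gcd. *)
  rewrite -hHN; apply: dvdz_gcd_mul.
    by rewrite dvdz_mul.
  by rewrite mulrC dvdz_mul.
set k := gcdz h H in k0 *.
have kh : (k %| h)%Z := dvdz_gcdl _ _.
have kH : (k %| H)%Z := dvdz_gcdr _ _.
have kN : (k %| N)%Z := dvdz_trans kh hN.
have ck z : coprimez N z -> coprimez k z.
  by rewrite ![coprimez _ z]coprimez_sym; exact: coprimez_dvdr.
(* [k] divides the difference and the sum, hence [2 * w * y0], and it is coprime to [y0]. *)
have k2w : (k %| 2 * w)%Z.
  rewrite -(@Gauss_dvdzl _ _ y0); last exact: (ck y0 cNy0).
  rewrite (_ : _ * _ = (w * y0 - w0 * y) + (w * y0 + w0 * y)); last by ring.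
  apply: rpredD; first exact: dvdz_trans kh (difh _ _ Eh).
  exact: dvdz_trans kH (sumH _ _ E Eh).
(* [k^2] divides [N = h * H] and [(2 * w)^2], hence [4 * D * y^2], and [k] is coprime to [y]. *)
have k4D : (k ^+ 2 %| 4 * D)%Z.
  rewrite -(@Gauss_dvdzl _ _ (y ^+ 2)); last first.
    by apply: coprimezXl; apply: coprimezXr; exact: ck.
  rewrite (_ : _ * _ = 4 * N - (2 * w) ^+ 2); last by rewrite -E; ring.
  by rewrite rpredB ?dvdz_exp2 // dvdz_mull // -hHN expr2 dvdz_mul.
have [q qE] := dvdzP k4D.
rewrite qE ler_peMl ?sqr_ge0 //.
have : 0 < q * k ^+ 2 by rewrite -qE mulr_gt0.
by rewrite pmulr_lgt0 ?exprn_gt0 //; lia.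
Qed.

(** Solutions are sorted by the divisor [gcd(N, w * y0 - w0 * y)], for a fixed solution [(w0, y0)].
    Within a class, relative to a second fixed solution, [k] times the cross term is [N * j] with
    [j] among five values, and [j] determines the solution. *)
Lemma at_most_rep_coprime (D N : nat) : (0 < D)%N -> (0 < N)%N ->
  at_most (fun x : nat * nat => (x.1 ^ 2 + D * x.2 ^ 2 = N)%N /\ coprime x.1 x.2)
    (tau N * 5).
Proof.
move=> D0 N0; apply: at_most_base => -[w0 y0] /= [E0 c0].
have toZ w y : (w ^ 2 + D * y ^ 2 = N)%N -> w%:Z ^+ 2 + D%:Z * y%:Z ^+ 2 = N%:Z.
  by move=> <-; rewrite !expr2 -!mulnn; lia.
apply: (@at_most_fiber _ _ _ (fun d => d %| N)%N
  (fun x : nat * nat => gcdn N (absz (x.1%:Z * y0%:Z - w0%:Z * x.2%:Z)%R))).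
- exact: at_most_dvdn.
- by move=> x _; exact: dvdn_gcdl.
move=> h; apply: at_most_base => -[w y] /= [[E c] Eh].
have DZ : 0 < D%:Z by lia.
have NZ : 0 < N%:Z by lia.
have cZ a b : coprime a b -> coprimez a%:Z b%:Z by rewrite coprimezE.
have gZ v z : gcdn N (absz (v%:Z * y0%:Z - w0%:Z * z%:Z)%R) = h ->
  gcdz N (v%:Z * y0%:Z - w0%:Z * z%:Z) = h%:Z by move=> <-.
have [k kE [k0 kD _]] := rep_class_cross DZ NZ (toZ _ _ E) (toZ _ _ E) (toZ _ _ E0)
  (cZ _ _ c) (cZ _ _ c0) (gZ _ _ Eh) (gZ _ _ Eh).
have cross w1 y1 : (w1 ^ 2 + D * y1 ^ 2 = N)%N -> coprime w1 y1 ->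
    gcdn N (absz (w1%:Z * y0%:Z - w0%:Z * y1%:Z)%R) = h ->
    (N%:Z %| k * (w1%:Z * y%:Z - w%:Z * y1%:Z))%Z.
  move=> E1 c1 Eh1; rewrite kE.
  by have [k' -> []] := rep_class_cross DZ NZ (toZ _ _ E1) (toZ _ _ E) (toZ _ _ E0)
    (cZ _ _ c1) (cZ _ _ c0) (gZ _ _ Eh1) (gZ _ _ Eh).
apply: (@at_most_inj _ _ _ (fun j : int => j \in [:: -2; -1; 0; 1; 2])
  (fun x : nat * nat => ((k * (x.1%:Z * y%:Z - w%:Z * x.2%:Z))%R %/ N%:Z)%Z)).
- exact: at_most_mem.
- move=> [w1 y1] /= [[E1 c1] Eh1].
  have /divzK := cross _ _ E1 c1 Eh1.
  set j := (_ %/ _)%Z => jN.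
  have := @rep_coprime_cross D N k j w1 y1 w y DZ NZ k0 kD (toZ _ _ E1) (toZ _ _ E).
  by rewrite -jN mulrC => /(_ erefl); rewrite !inE; lia.
move=> [w1 y1] [w2 y2] /= [[E1 c1] Eh1] [[E2 c2] Eh2] Ej.
have EC : w1%:Z * y%:Z - w%:Z * y1%:Z = w2%:Z * y%:Z - w%:Z * y2%:Z.
  apply: (@mulfI _ k); first by rewrite gt_eqF.
  by rewrite -(divzK (cross _ _ E1 c1 Eh1)) Ej divzK // cross.
have := rep_determined DZ NZ _ _ _ _ _ _ (toZ _ _ E) (toZ _ _ E1) (toZ _ _ E2) EC.
by case=> // -[->] [->].
Qed.

(** The gcd [g] of a solution divides [N], which gives the extra factor [tau N]. Dividing it out
    leaves a coprime representation of [N / g^2]. *)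
Lemma at_most_rep_nat (D N : nat) : (0 < D)%N -> (0 < N)%N ->
  at_most (fun x : nat * nat => (x.1 ^ 2 + D * x.2 ^ 2 = N)%N) (tau N * (tau N * 5)).
Proof.
move=> D0 N0.
apply: (@at_most_fiber _ _ _ (fun d => d %| N)%N (fun x : nat * nat => gcdn x.1 x.2)).
- exact: at_most_dvdn.
- move=> [w y] /= <-; apply: dvdn_add; last apply: dvdn_mull; apply: dvdn_exp => //.
    exact: dvdn_gcdl.
  exact: dvdn_gcdr.
move=> g; apply: at_most_base => -[w0 y0] [/= E0 g0E].
have g0 : (0 < g)%N.
  rewrite -g0E gcdn_gt0; apply: contraLR N0; rewrite -!eqn0Ngt -E0 negb_or -!eqn0Ngt.
  by case/andP=> /eqP -> /eqP ->; rewrite exp0n // muln0.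
have coprimeP w y : gcdn w y = g -> exists2 x : nat * nat,
    coprime x.1 x.2 & (w, y) = (x.1 * g, x.2 * g)%N.
  move=> gE; exists (w %/ g, y %/ g)%N; last by rewrite /= !divnK // -gE ?dvdn_gcdl ?dvdn_gcdr.
  by rewrite /coprime -(@eqn_pmul2r g) //= muln_gcdl !divnK ?mul1n ?gE // -gE ?dvdn_gcdl ?dvdn_gcdr.
have NE a b : ((a * g) ^ 2 + D * (b * g) ^ 2 = (a ^ 2 + D * b ^ 2) * g ^ 2)%N.
  by rewrite !expnMn mulnDl mulnA.
have divN a b : ((a * g) ^ 2 + D * (b * g) ^ 2 = N)%N ->
    (a ^ 2 + D * b ^ 2 = N %/ g ^ 2)%N.
  by move=> <-; rewrite NE mulnK // expn_gt0 g0.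
have gN : (g ^ 2 %| N)%N.
  by have [[a b] _ [aE bE]] := coprimeP _ _ g0E; rewrite -E0 aE bE NE dvdn_mull.
have N'0 : (0 < N %/ g ^ 2)%N by rewrite divn_gt0 ?expn_gt0 ?g0 // dvdn_leq.
have le : (tau (N %/ g ^ 2) * 5 <= tau N * 5)%N.
  by rewrite leq_mul2r dvd_tau_le // dvdn_div.
apply: (at_most_le le).
apply: (at_most_image (g := fun x : nat * nat => (x.1 * g, x.2 * g)%N)
  (at_most_rep_coprime D0 N'0)) => -[w y] [/= E gE].
have [[a b] cab wyE] := coprimeP w y gE; exists (a, b) => //; split=> //=.
by apply: divN; case: wyE => <- <-.
Qed.

(* The factor 4 accounts for the signs. *)
Lemma at_most_rep (D N : int) (M : nat) : 0 < D -> 0 < N -> (tau (absz N) <= M)%N ->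
  at_most (fun x : int * int => x.1 ^+ 2 + D * x.2 ^+ 2 = N) (20 * M ^ 2).
Proof.
move=> D0 N0 NM.
have le : (tau (absz N) * (tau (absz N) * 5) * (2 * 2) <= 20 * M ^ 2)%N.
  by rewrite -mulnn; nia.
apply: (at_most_le le).
apply: (@at_most_fiber _ _ _ (fun x : nat * nat => (x.1 ^ 2 + absz D * x.2 ^ 2 = absz N)%N)
  (fun x : int * int => (absz x.1, absz x.2))).
- by apply: at_most_rep_nat; lia.
- by move=> [w y] /= <-; rewrite -!mulnn !expr2; lia.
move=> [a b].
apply: (@at_most_inj _ _ _ (fun x : bool * bool => True /\ True)
  (fun x : int * int => (0 <= x.1, 0 <= x.2))) => //.
- by apply: (at_most_pair (P := fun=> True) (Q := fun=> True)); exact: at_most_bool.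
- move=> [w y] [w' y'] /= [_ [wa yb]] [_ [wa' yb']] [sw sy].
  by congr pair; lia.
Qed.

(** * Traces on fields generated by square roots *)

Definition is_square (N : nat) : Prop := exists k, (k ^ 2 = N)%N.

Definition subfield (R : realType) (F : R -> Prop) : Prop :=
  [/\ F 1, forall x y, F x -> F y -> F (x - y), forall x y, F x -> F y -> F (x * y)
    & forall x, F x -> F x^-1].

(* On F = Q(sqrt a_1, ..., sqrt a_k), T is the normalized trace to Q: it kills
   the square root of every non-square, which is all the linear independence
   of square roots needed here. *)
Definition sqrt_trace (R : realType) (F : R -> Prop) (T : R -> R) : Prop :=
  (forall x y, F x -> F y -> T (x + y) = T x + T y) /\
  forall N : nat, F (Num.sqrt N%:R) ->
    (is_square N -> T (Num.sqrt N%:R) = Num.sqrt N%:R) /\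
    (~ is_square N -> T (Num.sqrt N%:R) = 0).

Section SubfieldTheory.
Variables (R : realType) (F : R -> Prop).
Hypothesis sF : subfield F.

Lemma subfield1 : F 1. Proof. by case: sF. Qed.
Lemma subfieldB x y : F x -> F y -> F (x - y). Proof. by case: sF => _ + _ _; exact. Qed.
Lemma subfieldM x y : F x -> F y -> F (x * y). Proof. by case: sF => _ _ + _; exact. Qed.
Lemma subfieldV x : F x -> F x^-1. Proof. by case: sF => _ _ _; exact. Qed.
Lemma subfield0 : F 0. Proof. by rewrite -(subrr 1); apply: subfieldB; exact: subfield1. Qed.
Lemma subfieldN x : F x -> F (- x).
Proof. by move=> Fx; rewrite -sub0r; exact: subfieldB subfield0 Fx. Qed.
Lemma subfieldD x y : F x -> F y -> F (x + y).
Proof. by move=> Fx Fy; rewrite -(opprK y); apply: subfieldB => //; exact: subfieldN. Qed.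
Lemma subfield_nat (n : nat) : F n%:R.
Proof.
elim: n => [|n IH]; first exact: subfield0.
by rewrite -natr1; exact: subfieldD IH subfield1.
Qed.

End SubfieldTheory.

(** The denominator divides the square of the numerator and is coprime to it, so it is 1. *)
Lemma rat_sqr_natP (R : realType) (q : rat) (N : nat) :
  (ratr q : R) ^+ 2 = N%:R -> is_square N.
Proof.
move=> qN; have {qN} qN : q ^+ 2 = N%:R.
  by apply: (fmorph_inj (@ratr R)); rewrite rmorphXn /= qN rmorph_nat.
have nd : numq q * numq q = N%:Z * (denq q * denq q).
  apply: (@intr_inj rat); rewrite !intrM -[N%:Z%:~R]/(N%:R) -qN expr2.
  by rewrite [RHS]mulrACA -numqE.
have : (denq q %| numq q * numq q)%Z by rewrite nd mulrA dvdz_mull.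
have cop : coprimez (denq q) (numq q) by rewrite coprimez_sym coprimezE coprime_num_den.
rewrite Gauss_dvdzr // -[X in (_ %| X)%Z]mulr1 Gauss_dvdzr // dvdz1 => d1.
have dq : denq q = 1 by have := denq_gt0 q; lia.
by exists (absz (numq q)); move: nd; rewrite dq -mulnn; lia.
Qed.

(** If [r = sqrt a] is not in [F], then [F + F r] is a field with unique coordinates, and the new
    trace is [T] of the [F]-coordinate. A root [sqrt N] outside [F] must be a pure multiple of [r],
    so its trace is 0. *)
Lemma sqrt_trace_adjoin (R : realType) (F : R -> Prop) (T : R -> R) (a : nat) :
  subfield F -> sqrt_trace F T ->
  exists F' T', [/\ subfield F', sqrt_trace F' T', F' (Num.sqrt a%:R)
                  & forall x, F x -> F' x].
Proof.
move=> sF [TD Tsq]; set r : R := Num.sqrt a%:R.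
have [Fr|nFr] := pselect (F r); first by exists F, T; split.
have rr : r * r = a%:R by rewrite -expr2 sqr_sqrtr.
pose F' (x : R) := exists y z, [/\ F y, F z & x = y + z * r].
have uniq_dec y z y' z' : F y -> F z -> F y' -> F z' ->
    y + z * r = y' + z' * r -> y = y' /\ z = z'.
  move=> Fy Fz Fy' Fz' E.
  have [zz|zz] := eqVneq z z'; first by move: E; rewrite zz => /addIr.
  exfalso; apply: nFr; have z0 : z - z' != 0 by rewrite subr_eq0.
  have -> : r = (y' - y) * (z - z')^-1.
    by apply: (mulIf z0); rewrite divfK // mulrC mulrBl; lra.
  by apply: (subfieldM sF); [|apply: (subfieldV sF)]; apply: (subfieldB sF).
(* [xget] selects the [F]-coordinate of [x]; the value 0 is a default outside [F']. *)
pose T' (x : R) := T (xget 0 [set y | F y /\ exists2 z, F z & x = y + z * r]).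
have T'E y z : F y -> F z -> T' (y + z * r) = T y.
  move=> Fy Fz; rewrite /T'; case: xgetP => [y' _ [Fy' [z' Fz' /uniq_dec]]|].
    by case=> // ->.
  by move=> /(_ y)[]; split => //; exists z.
have FF' x : F x -> F' x.
  by move=> Fx; exists x, 0; rewrite mul0r addr0; split=> //; exact: subfield0 sF.
have zrF y z : F y -> F z -> z != 0 -> y <> z * r.
  move=> Fy Fz z0 E; apply: nFr; have -> : r = y * z^-1 by rewrite E mulrC mulKf.
  by apply: (subfieldM sF) => //; exact: (subfieldV sF).
exists F', T'; split => //.
- split; first by apply: FF'; exact: subfield1 sF.
  + move=> _ _ [y [z [Fy Fz ->]]] [y' [z' [Fy' Fz' ->]]].
    exists (y - y'), (z - z'); split; [exact: subfieldB|exact: subfieldB|by ring].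
  + move=> _ _ [y [z [Fy Fz ->]]] [y' [z' [Fy' Fz' ->]]].
    exists (y * y' + z * z' * a%:R), (y * z' + z * y').
    split; last by rewrite -rr; ring.
      by apply: (subfieldD sF); repeat (apply: (subfieldM sF) => //); exact: subfield_nat.
    by apply: (subfieldD sF); apply: (subfieldM sF).
  + move=> _ [y [z [Fy Fz ->]]].
    have [z0|z0] := eqVneq z 0.
      by rewrite z0 mul0r addr0; apply: FF'; exact: subfieldV.
    (* The norm of [y + z * r] vanishes only if [y = z * r] or [y = - z * r], which would put [r] in
       [F]. *)
    have n0 : y ^+ 2 - z ^+ 2 * a%:R != 0.
      rewrite -rr (_ : _ - _ = (y - z * r) * (y - - z * r)); last by ring.
      rewrite mulf_eq0 !subr_eq0; apply/norP; split; apply/eqP; apply: zrF => //.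
        exact: subfieldN.
      by rewrite oppr_eq0.
    have Fn : F (y ^+ 2 - z ^+ 2 * a%:R).
      rewrite !expr2; apply: (subfieldB sF); repeat (apply: (subfieldM sF) => //).
      exact: subfield_nat.
    (* The inverse is the conjugate divided by the norm. *)
    exists (y * (y ^+ 2 - z ^+ 2 * a%:R)^-1), ((- z) * (y ^+ 2 - z ^+ 2 * a%:R)^-1).
    split; [| |].
    * by apply: (subfieldM sF) => //; exact: subfieldV.
    * by apply: (subfieldM sF); [exact: subfieldN|exact: subfieldV].
    * have yz0 : y + z * r != 0.
        apply: contra n0 => /eqP E; rewrite -rr.
        have -> : y ^+ 2 - z ^+ 2 * (r * r) = (y - z * r) * (y + z * r) by ring.
        by rewrite E mulr0.
      have n0r : y ^+ 2 - z ^+ 2 * (r * r) != 0 by rewrite rr.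
      rewrite -rr; clear -yz0 n0r; clearbody r.
      by field; rewrite n0r.
- split.
    move=> _ _ [y [z [Fy Fz ->]]] [y' [z' [Fy' Fz' ->]]].
    rewrite (_ : _ + _ = (y + y') + (z + z') * r); last by ring.
    by rewrite !T'E ?TD //; exact: subfieldD.
  move=> N [y [z [Fy Fz E]]].
  have [z0|z0] := eqVneq z 0.
    have Ey : Num.sqrt N%:R = y by rewrite E z0 mul0r addr0.
    have := T'E _ _ Fy Fz; rewrite z0 mul0r addr0 -Ey => ->.
    by apply: Tsq; rewrite Ey.
  have NN : N%:R = y ^+ 2 + z ^+ 2 * a%:R + 2 * (y * z) * r.
    by rewrite -[LHS]sqr_sqrtr ?ler0n // E -rr; ring.
  (* Otherwise the equation [NN] can be solved for [r] inside [F]. *)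
  have y0 : y = 0.
    apply/eqP/negP => /negP y0.
    apply: (@zrF (N%:R - y ^+ 2 - z ^+ 2 * a%:R) (2 * (y * z))).
    - have Fn n : F n%:R := subfield_nat sF n.
      by rewrite !expr2; repeat (apply: (subfieldB sF) => // || apply: (subfieldM sF) => //).
    - by repeat (apply: (subfieldM sF) => //); exact: (subfield_nat sF 2).
    - by rewrite !mulf_neq0.
    - by rewrite {}NN; ring.
  have T0 : T 0 = 0.
    have := TD 0 0 (subfield0 sF) (subfield0 sF); rewrite addr0.
    by move=> /(congr1 (fun t => t - T 0)); rewrite subrr addrK.
  split=> [[k kN]|_]; last by rewrite E T'E // y0 T0.
  exfalso; apply: (zrF (Num.sqrt N%:R) z) => //; last by rewrite E y0 add0r.
  by rewrite -kN natrX sqrtr_sqr normr_nat; exact: (subfield_nat sF).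
- by exists 0, 1; rewrite add0r mul1r; split => //; [exact: subfield0|exact: subfield1].
Qed.

Lemma sqrt_trace_exists (R : realType) (l : seq nat) :
  exists F (T : R -> R), [/\ subfield F, sqrt_trace F T
                           & forall a, a \in l -> F (Num.sqrt a%:R)].
Proof.
elim: l => [|a l [F [T [sF FT Fl]]]]; last first.
  have [F' [T' [sF' FT' Fa FF']]] := sqrt_trace_adjoin a sF FT.
  exists F', T'; split => // b; rewrite inE => /orP[/eqP -> //|/Fl /FF' //].
(* The base field is the rationals, with the identity as trace. *)
exists (fun x => exists q : rat, ratr q = x), id; split => //.
  split; first by exists 1; rewrite rmorph1.
  - by move=> _ _ [p <-] [q <-]; exists (p - q); rewrite rmorphB.
  - by move=> _ _ [p <-] [q <-]; exists (p * q); rewrite rmorphM.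
  - by move=> _ [p <-]; exists p^-1; rewrite fmorphV.
split=> // N [q qN]; split=> // -[]; apply: (@rat_sqr_natP R q).
by rewrite qN sqr_sqrtr.
Qed.

(** Multiply by [sqrt e1] and take traces. The right side is at least [e1 > 0], while the left side
    is 0 if no [d_i * e1] is a square. *)
Lemma sum_sqrt_class (R : realType) (d1 d2 d3 e1 e2 e3 : nat) : (0 < e1)%N ->
  Num.sqrt (d1%:R : R) + Num.sqrt d2%:R + Num.sqrt d3%:R =
    Num.sqrt e1%:R + Num.sqrt e2%:R + Num.sqrt e3%:R ->
  [\/ is_square (d1 * e1), is_square (d2 * e1) | is_square (d3 * e1)].
Proof.
move=> e10 E.
have [F [T [sF [TD Tsq] Fl]]] := sqrt_trace_exists R [:: d1; d2; d3; e1; e2; e3].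
have sqM (a : nat) : Num.sqrt (a * e1)%:R = Num.sqrt a%:R * Num.sqrt e1%:R :> R.
  by rewrite natrM sqrtrM.
have FM a : a \in [:: d1; d2; d3; e1; e2; e3] -> F (Num.sqrt (a * e1)%:R).
  by move=> al; rewrite sqM; apply: (subfieldM sF); apply: Fl => //; rewrite !inE eqxx ?orbT.
have [F1 F2 F3] : [/\ F (Num.sqrt (d1 * e1)%:R), F (Num.sqrt (d2 * e1)%:R)
    & F (Num.sqrt (d3 * e1)%:R)] by split; apply: FM; rewrite !inE eqxx ?orbT.
have [G1 G2 G3] : [/\ F (Num.sqrt (e1 * e1)%:R), F (Num.sqrt (e2 * e1)%:R)
    & F (Num.sqrt (e3 * e1)%:R)] by split; apply: FM; rewrite !inE eqxx ?orbT.
have TE : T (Num.sqrt (d1 * e1)%:R) + T (Num.sqrt (d2 * e1)%:R) + T (Num.sqrt (d3 * e1)%:R)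
  = T (Num.sqrt (e1 * e1)%:R) + T (Num.sqrt (e2 * e1)%:R) + T (Num.sqrt (e3 * e1)%:R).
  have TD3 x y z : F x -> F y -> F z -> T x + T y + T z = T (x + y + z).
    by move=> Fx Fy Fz; rewrite !TD //; exact: subfieldD.
  by rewrite !TD3 // !sqM -!mulrDl E.
have T0 N : F (Num.sqrt N%:R) -> 0 <= T (Num.sqrt N%:R).
  move=> /Tsq[sq nsq]; have [/sq ->|/nsq -> //] := pselect (is_square N).
  exact: sqrtr_ge0.
have [|n1] := pselect (is_square (d1 * e1)); first by constructor 1.
have [|n2] := pselect (is_square (d2 * e1)); first by constructor 2.
have [|n3] := pselect (is_square (d3 * e1)); first by constructor 3.
have T1 : 0 < T (Num.sqrt (e1 * e1)%:R).
  rewrite (Tsq _ G1).1; last by exists e1; rewrite mulnn.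
  by rewrite sqrtr_gt0 ltr0n muln_gt0 e10.
move: TE (T0 _ G2) (T0 _ G3).
by rewrite (Tsq _ F1).2 // (Tsq _ F2).2 // (Tsq _ F3).2 //; lra.
Qed.

(** * Integer vectors and square classes *)

Definition sqn (u : int * int) : nat := (absz u.1 ^ 2 + absz u.2 ^ 2)%N.

Definition cross (u v : int * int) : int := u.1 * v.2 - u.2 * v.1.

Definition within (m : nat) (u : int * int) : Prop :=
  (absz u.1 <= m)%N /\ (absz u.2 <= m)%N.

Lemma sqnE u : (sqn u)%:Z = u.1 ^+ 2 + u.2 ^+ 2.
Proof. by rewrite /sqn -!mulnn !expr2; lia. Qed.

Lemma sqn_le m u : within m u -> (sqn u <= 2 * m ^ 2)%N.
Proof. by rewrite /sqn -!mulnn => -[]; nia. Qed.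

Lemma sqn_gt0l u v : cross u v <> 0 -> (0 < sqn u)%N.
Proof.
case: u v => [a b] [c d]; rewrite /cross /sqn /= -!mulnn => E.
have [a0|a0] := eqVneq a 0; last by nia.
have [b0|b0] := eqVneq b 0; last by nia.
by case: E; rewrite a0 b0; ring.
Qed.

Lemma exists_nat_sqrt (d : nat) : exists r, (r ^ 2 <= d < r.+1 ^ 2)%N.
Proof.
elim: d => [|d [r /andP[rd dr]]]; first by exists 0%N.
have [lt|ge] := ltnP d.+1 (r.+1 ^ 2).
  by exists r; rewrite lt andbT (leq_trans rd).
by exists r.+1; rewrite ge /= (leq_ltn_trans dr) // ltn_exp2r.
Qed.

(* Square roots of distinct integers in a square class differ by at least 1,
   because the square of the difference is a positive integer. *)
Lemma at_most_square_class (e L : nat) : (0 < e)%N ->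
  at_most (fun d => (d <= L ^ 2)%N /\ is_square (d * e)) L.+1.
Proof.
move=> e0; have [f fP] := choice exists_nat_sqrt.
apply: (@at_most_inj _ _ _ (fun i : nat => (i <= L)%N) f); first exact: at_most_leq.
  move=> d [dL _]; have /andP[fd _] := fP d.
  by rewrite -(@leq_exp2r _ _ 2) // (leq_trans fd).
move=> d d' [_ [k kE]] [_ [k' kE']] ff.
(* Two members of one square class have a square product: [e^2] divides [(k * k')^2]. *)
have [s sE] : is_square (d * d').
  have : (e ^ 2 %| (k * k') ^ 2)%N.
    by rewrite expnMn kE kE' mulnACA mulnn dvdn_mull.
  rewrite dvdn_pexp2r // => /dvdnP[s sE]; exists s.
  have : (s ^ 2 * e ^ 2 = d * d' * e ^ 2)%N.
    by rewrite -expnMn -sE expnMn kE kE' mulnACA mulnn.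
  by move/eqP; rewrite eqn_pmul2r ?expn_gt0 ?e0 // => /eqP.
move: (fP d) (fP d'); rewrite -ff; set r := f d; clearbody r.
rewrite -!mulnn in sE *; clear -sE.
wlog dd' : d d' sE / (d <= d')%N.
  move=> H; have [|/ltnW] := leqP d d'; first exact: H.
  by move=> le b1 b2; apply/esym; apply: H => //; rewrite sE mulnC.
move=> /andP[r1 r2] /andP[r3 r4]; apply/eqP; rewrite eqn_leq dd' /=.
rewrite leqNgt; apply/negP => lt.
have [t tE] : exists t, d' = (d + t.+1)%N by exists (d' - d.+1)%N; lia.
have t2 : (t.+1 <= 2 * r)%N by nia.
have s1 : (d <= s)%N by nia.
have [z zE] : exists z, s = (d + z)%N by exists (s - d)%N; lia.
subst s d'.
(* [t + 1 - 2 * z] is [d + d' - 2 * sqrt (d * d')], the squared difference of the roots. *)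
have z1 : (2 * z < t.+1)%N by nia.
have z2 : (2 * z <= t)%N by lia.
(* [z^2 = d * (t + 1 - 2 * z) >= r^2] forces [z >= r], against [2 * z <= t < 2 * r]. *)
by nia.
Qed.

(** * Sums of side lengths *)

Section UpperBound.
Variable R : realType.

Definition sqrtn (d : nat) : R := Num.sqrt d%:R.

Lemma sqrtn_ge0 d : 0 <= sqrtn d. Proof. exact: sqrtr_ge0. Qed.

Lemma sqr_sqrtn d : sqrtn d ^+ 2 = d%:R. Proof. by rewrite sqr_sqrtr. Qed.

Lemma sqrtnM a b : sqrtn (a * b) = sqrtn a * sqrtn b.
Proof. by rewrite /sqrtn natrM sqrtrM. Qed.

(** Each [d] lies in the square class of one of the three terms of a fixed decomposition of [p]. *)
Lemma at_most_side (L : nat) (p : R) :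
  at_most (fun d => [/\ (0 < d)%N, (d <= L ^ 2)%N & exists e f,
     [/\ (0 < e)%N, (0 < f)%N & sqrtn d + sqrtn e + sqrtn f = p]]) (3 * L.+1).
Proof.
apply: at_most_base => d1 [d10 _ [d2 [d3 [d20 d30 <-]]]].
have -> : (3 * L.+1 = L.+1 + L.+1 + L.+1)%N by lia.
have H := at_most_or (at_most_or (at_most_square_class (L := L) d10)
  (at_most_square_class (L := L) d20)) (at_most_square_class (L := L) d30).
apply: (at_most_sub H) => // d [d0 dL [e [f [e0 f0 E]]]].
have [] := sum_sqrt_class d0 (esym E); rewrite mulnC; tauto.
Qed.

Lemma sqrtn_rat_square (P S : nat) (z : int) : z != 0 ->
  4 * P%:R = z%:~R ^+ 2 + 4 * S%:R + 4 * z%:~R * sqrtn S -> is_square S.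
Proof.
move=> z0 E; apply: (@rat_sqr_natP R ((4 * P%:R - z%:~R ^+ 2 - 4 * S%:R) / (4 * z%:~R))).
rewrite -[RHS]sqr_sqrtn; congr (_ ^+ 2).
rewrite fmorph_div !rmorphB !rmorphM /= !ratr_int !ratr_nat E.
by field; rewrite intr_eq0.
Qed.

(** Squaring once compares [a + b] with [c + d]. If these differ, squaring again makes
    [sqrt (c * d)] rational. So sums and products agree, and both pairs are the roots of one
    quadratic. *)
Lemma sum_sqrt2_eq (a b c d : nat) : ~ is_square (c * d) ->
  sqrtn a + sqrtn b = sqrtn c + sqrtn d -> c = a \/ c = b.
Proof.
move=> nsq E; have E2 : (a + b)%:R + 2 * sqrtn (a * b) = (c + d)%:R + 2 * sqrtn (c * d) :> R.
  rewrite !natrD !sqrtnM -(sqr_sqrtn a) -(sqr_sqrtn b) -(sqr_sqrtn c) -(sqr_sqrtn d).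
  have := congr1 (fun x => x ^+ 2) E => /=.
  by rewrite !sqrrD; lra.
set z : int := (c + d)%:Z - (a + b)%:Z.
have zE : z%:~R = (c + d)%:R - (a + b)%:R :> R by rewrite intrB.
have E3 : 4 * (a * b)%:R = z%:~R ^+ 2 + 4 * (c * d)%:R + 4 * z%:~R * sqrtn (c * d) :> R.
  rewrite -(sqr_sqrtn (a * b)) -(sqr_sqrtn (c * d)).
  have -> : sqrtn (a * b) = (z%:~R + 2 * sqrtn (c * d)) / 2 by rewrite zE; lra.
  by field.
have z0 : z = 0.
  by apply/eqP/negP => /negP z0; apply: nsq; exact: sqrtn_rat_square z0 E3.
have sE : (a + b = c + d)%N by move: z0; rewrite /z; lia.
have pE : (a * b = c * d)%N.
  apply/eqP; rewrite -(@eqr_nat R); apply/eqP.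
  by move: E3; rewrite z0; lra.
have : (c%:Z - a%:Z) * (c%:Z - b%:Z) = 0 by nia.
by move/eqP; rewrite mulf_eq0 => /orP[]; [left|right]; lia.
Qed.

End UpperBound.

(** * Lattice points on an ellipse *)

Lemma sqnB_dot (u v : int * int) :
  (sqn (v - u)%R)%:Z = (sqn v)%:Z + (sqn u)%:Z - 2 * (u.1 * v.1 + u.2 * v.2).
Proof. by rewrite !sqnE /=; ring. Qed.

(** The dot and cross products with [u] are the real and imaginary parts of [v] times the conjugate
    of [u]; multiplying by [u] gives [|u|^2 v]. *)
Lemma cross_dot_inj u v w : cross u v <> 0 ->
  u.1 * v.1 + u.2 * v.2 = u.1 * w.1 + u.2 * w.2 -> cross u v = cross u w -> v = w.
Proof.
case: u v w => [a b] [c d] [x y] uv; have u0 := sqn_gt0l uv.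
have D0 : (sqn (a, b))%:Z != 0 by lia.
rewrite /cross /= => E1 E2; congr pair; apply: (mulfI D0); rewrite sqnE /=.
  have -> : (a ^+ 2 + b ^+ 2) * c = a * (a * c + b * d) - b * (a * d - b * c) by ring.
  by rewrite E1 E2; ring.
have -> : (a ^+ 2 + b ^+ 2) * d = b * (a * c + b * d) + a * (a * d - b * c) by ring.
by rewrite E1 E2; ring.
Qed.

(* Points v on an ellipse with foci 0 and u. If q ^ 2 is irrational, then the
   two focal distances are determined; otherwise Q = q ^ 2 is an integer and,
   with e = Q - |u|^2 > 0, the pair (e (2 u.v - |u|^2), 2 (u x v)) represents
   e^2 |u|^2 Q by the form X^2 + e Q Y^2. *)
Lemma at_most_ellipse (R : realType) (m M : nat) (q : R) (u : int * int) :
  (forall N, 0 < N <= 1024 * m ^ 8 -> tau N <= M)%N ->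
  within m u ->
  at_most (fun v => [/\ within m v, within m (v - u)%R, cross u v <> 0
    & sqrtn R (sqn v) + sqrtn R (sqn (v - u)%R) = q]) (40 * M ^ 2).
Proof.
move=> tauM wu.
(* In the first case [q ^+ 2 = |v0|^2 + |v0 - u|^2 + 2 * k] is an integer. *)
have [[v0 [[wv0 wuv0 uv0 Eq0] [k kE]]]|nsq] := pselect (exists v0,
  [/\ within m v0, within m (v0 - u)%R, cross u v0 <> 0
    & sqrtn R (sqn v0) + sqrtn R (sqn (v0 - u)%R) = q] /\
  is_square (sqn v0 * sqn (v0 - u)%R)); last first.
  apply: at_most_base => v0 [wv0 wuv0 uv0 Eq0].
  have small v : within m v -> (0 < sqn v)%N -> (tau (absz (sqn v)%:Z) <= M)%N.
    move=> wv v0'; apply: tauM; rewrite v0' /=; apply: (leq_trans (sqn_le wv)).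
    have m0 : (0 < m)%N by move: wv v0' => [+ +]; rewrite /sqn -!mulnn; case: (m) => // -[]; nia.
    by rewrite leq_mul // leq_pexp2l.
  have rep v : within m v -> (0 < sqn v)%N ->
      at_most (fun x : int * int => sqn x = sqn v) (20 * M ^ 2).
    move=> wv v1; have vZ : 0 < (sqn v)%:Z by lia.
    apply: (at_most_sub (at_most_rep (D := 1) _ vZ (small v wv v1))) => // x xE.
    by rewrite -xE sqnE mul1r.
  have sv0 : (0 < sqn v0)%N.
    by apply: (@sqn_gt0l v0 u) => E; apply: uv0; move: E; rewrite /cross; lia.
  have suv0 : (0 < sqn (v0 - u)%R)%N.
    by apply: (@sqn_gt0l _ u) => E; apply: uv0; move: E; rewrite /cross /=; lia.
  (* [|v|] equals [|v0|] or [|v0 - u|], and each value allows [20 * M ^ 2] vectors. *)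
  have -> : (40 * M ^ 2 = 20 * M ^ 2 + 20 * M ^ 2)%N by lia.
  apply: (at_most_sub (at_most_or (rep _ wv0 sv0) (rep _ wuv0 suv0))) => // v [wv wuv uv Ev].
  have nsqv : ~ is_square (sqn v * sqn (v - u)%R) by move=> sq; apply: nsq; exists v.
  exact: (sum_sqrt2_eq nsqv (etrans Eq0 (esym Ev))).
pose D := (sqn u)%:Z.
have D0 : 0 < D by rewrite /D; have := sqn_gt0l uv0; lia.
pose Q := (sqn v0 + sqn (v0 - u)%R + 2 * k)%N%:Z.
have qQ : q ^+ 2 = Q%:~R.
  rewrite -Eq0 sqrrD !sqr_sqrtn -sqrtnM -kE /sqrtn natrX sqrtr_sqr normr_nat.
  by rewrite /Q; lra.
have q0 : 0 <= q by rewrite -Eq0 addr_ge0 ?sqrtn_ge0.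
pose e := Q - D.
pose i0 := u.1 * v0.1 + u.2 * v0.2.
have kD : k%:Z ^+ 2 = (sqn v0)%:Z * (sqn (v0 - u)%R)%:Z.
  by rewrite -PoszM -kE expr2 -mulnn; lia.
(* Lagrange's identity for [v0] and [v0 - u], whose lengths have product [k]. *)
have lag : ((sqn v0)%:Z - i0) ^+ 2 + cross u v0 ^+ 2 = k%:Z ^+ 2.
  by rewrite kD sqnB_dot !sqnE /i0 /cross; ring.
have eE : e = 2 * (k%:Z + ((sqn v0)%:Z - i0)).
  have -> : e = (sqn v0)%:Z + (sqn (v0 - u)%R)%:Z + 2 * k%:Z - (sqn u)%:Z.
    by rewrite /e /Q /D; lia.
  by rewrite sqnB_dot -/i0; ring.
(* By [lag] and [cross u v0 <> 0], the dot product of [v0] and [v0 - u] is less than [k] in absolute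
   value. *)
have e0 : 0 < e.
  rewrite eE; move: lag uv0; set x := (sqn v0)%:Z - i0; set c := cross u v0 => lag c0.
  clear -lag c0; have : 0 < c ^+ 2 by rewrite exprn_even_gt0 //=; apply/eqP.
  by nia.
have Q0 : 0 < Q by rewrite /Q; have := e0; rewrite /e /D; lia.
have k_le : (k <= 2 * m ^ 2)%N.
  rewrite -(@leq_exp2r _ _ 2) // kE -mulnn; apply: leq_mul; exact: sqn_le.
have D_le : D <= 2 * (m ^ 2)%N%:Z by rewrite /D; have := sqn_le wu; lia.
have Q_le : Q <= 8 * (m ^ 2)%N%:Z.
  by rewrite /Q; have := sqn_le wv0; have := sqn_le wuv0; lia.
have e_le : e <= 8 * (m ^ 2)%N%:Z by rewrite /e; lia.
have N0 : 0 < e ^+ 2 * D * Q by rewrite !mulr_gt0 // exprn_gt0.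
(* [1024 = 8^2 * 2 * 8], from the bounds on [e], [D] and [Q]. *)
have N_le : (absz (e ^+ 2 * D * Q)%R <= 1024 * m ^ 8)%N.
  have : e ^+ 2 * D * Q <= (8 * (m ^ 2)%N%:Z) ^+ 2 * (2 * (m ^ 2)%N%:Z) * (8 * (m ^ 2)%N%:Z).
    have e2 : e ^+ 2 <= (8 * (m ^ 2)%N%:Z) ^+ 2.
      by rewrite ler_pXn2r // nnegrE ?(ltW e0) // (le_trans (ltW e0)).
    have eD : e ^+ 2 * D <= (8 * (m ^ 2)%N%:Z) ^+ 2 * (2 * (m ^ 2)%N%:Z).
      exact: ler_pM (sqr_ge0 _) (ltW D0) e2 D_le.
    by apply: ler_pM eD Q_le; rewrite ?mulr_ge0 ?sqr_ge0 // ltW.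
  have -> : (m ^ 8 = m ^ 2 * m ^ 2 * (m ^ 2 * m ^ 2))%N by rewrite -!expnD.
  by rewrite expr2; lia.
have tN : (tau (absz (e ^+ 2 * D * Q)%R) <= M)%N by apply: tauM; rewrite N_le andbT; lia.
apply: (@at_most_le _ _ (20 * M ^ 2)); first by rewrite leq_mul2r orbT.
apply: (at_most_inj (at_most_rep (D := e * Q) _ N0 tN)
  (f := fun v => (e * (2 * (u.1 * v.1 + u.2 * v.2) - D), 2 * cross u v))).
- by rewrite mulr_gt0.
- move=> v [_ _ _ Ev] /=; set x := u.1 * v.1 + u.2 * v.2.
  (* Squaring [|v - u| = q - |v|] gives [e + 2 * x = 2 * q * |v|]. *)
  have ell : (e + 2 * x) ^+ 2 = 4 * Q * (sqn v)%:Z.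
    apply: (@intr_inj R); rewrite rmorphXn /= !intrM -qQ -[(sqn v)%:Z%:~R]/((sqn v)%:R).
    rewrite -(sqr_sqrtn R (sqn v)).
    have -> : (e + 2 * x)%:~R = 2 * q * sqrtn R (sqn v).
      have sB : sqrtn R (sqn (v - u)%R) ^+ 2 = (q - sqrtn R (sqn v)) ^+ 2.
        by congr (_ ^+ 2); rewrite -Ev; ring.
      have sZ : (sqn (v - u)%R)%:R = (sqn v)%:R + (sqn u)%:R - 2 * x%:~R :> R.
        by rewrite -[LHS]/((sqn (v - u)%R)%:Z%:~R) sqnB_dot -/x intrB intrD intrM.
      move: sB; rewrite sqr_sqrtn sZ sqrrB sqr_sqrtn qQ.
      rewrite /e intrD intrB intrM -[D%:~R]/((sqn u)%:R).
      by lra.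
    by ring.
  have lagv : x ^+ 2 + cross u v ^+ 2 = D * (sqn v)%:Z.
    by rewrite /D !sqnE /cross /x; ring.
  have QE : Q = e + D by rewrite /e subrK.
  have key : 4 * Q * (D * (sqn v)%:Z) = D * (e + 2 * x) ^+ 2 by rewrite ell; ring.
  have c2 : 4 * Q * cross u v ^+ 2 = D * (e + 2 * x) ^+ 2 - 4 * Q * x ^+ 2.
    by rewrite -key -lagv; ring.
  have -> : (e * (2 * x - D)) ^+ 2 + e * Q * (2 * cross u v) ^+ 2
    = (e * (2 * x - D)) ^+ 2 + e * (4 * Q * cross u v ^+ 2) by ring.
  by rewrite c2 QE; ring.
move=> v w [_ _ uv _] [_ _ uw _] [E1 E2].
apply: (cross_dot_inj uv); last by apply: (@mulfI _ 2).
by move: (mulfI (negbT (gt_eqF e0)) E1) => /addIr; apply: mulfI.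
Qed.

(** * Integer triangles in the grid *)

Definition in_box (m : nat) (a : int * int) : Prop :=
  [/\ 1 <= a.1, a.1 <= m%:Z, 1 <= a.2 & a.2 <= m%:Z].

Lemma in_boxB m a b : in_box m a -> in_box m b -> within m (a - b).
Proof. by move=> [? ? ? ?] [? ? ? ?]; split=> /=; lia. Qed.

Lemma at_most_box m : at_most (in_box m) (m * m).
Proof.
have H := at_most_pair (@at_most_mem _ (iota 1 m)) (@at_most_mem _ (iota 1 m)).
rewrite size_iota in H.
apply: (at_most_inj H (f := fun a : int * int => (absz a.1, absz a.2))).
  by move=> a [? ? ? ?]; split; rewrite mem_iota /=; lia.
move=> [a b] [c d] [/= ? ? ? ?] [/= ? ? ? ?] [? ?]; congr pair; lia.
Qed.

Lemma sqnN u : sqn (- u) = sqn u.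
Proof. by rewrite /sqn /= !abszN. Qed.

(** Vertices are ordered here; every vertex set comes from some ordering, which is enough for an
    upper bound. *)
Definition int_triangle (R : realType) (m : nat) (p : R)
    (t : (int * int) * (int * int) * (int * int)) : Prop :=
  let: (a, b, c) := t in
  [/\ in_box m a, in_box m b, in_box m c, cross (b - a) (c - a) <> 0
    & sqrtn R (sqn (b - a)) + sqrtn R (sqn (c - b)) + sqrtn R (sqn (a - c)) = p].

(** The factors count [a], the squared length of [u = b - a], the vector [u] of that length, and
    [c - a] on an ellipse with foci 0 and [u] and distance sum [p - |u|]. *)
Lemma at_most_int_triangle (R : realType) (m M : nat) (p : R) :
  (forall N, 0 < N <= 1024 * m ^ 8 -> tau N <= M)%N ->
  at_most (int_triangle m p)
    (m * m * (3 * (2 * m).+1 * (20 * M ^ 2)) * (40 * M ^ 2)).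
Proof.
move=> tauM.
pose side d := [/\ (0 < d)%N, (d <= (2 * m) ^ 2)%N & exists e f,
  [/\ (0 < e)%N, (0 < f)%N & sqrtn R d + sqrtn R e + sqrtn R f = p]].
have Hside : at_most (fun u : int * int => within m u /\ side (sqn u))
    (3 * (2 * m).+1 * (20 * M ^ 2)).
  have Hs := @at_most_side R (2 * m) p.
  apply: (@at_most_fiber _ _ _ side sqn _ _ Hs) => [u []//|d].
  apply: at_most_base => u [[wu [u0 _ _]] ud].
  have dZ : 0 < d%:Z by rewrite -ud; lia.
  have m0 : (0 < m)%N by move: wu u0 => [+ +]; rewrite /sqn -!mulnn; case: (m) => // -[]; nia.
  have td : (tau (absz d%:Z) <= M)%N.
    apply: tauM; rewrite -ud u0 /= (leq_trans (sqn_le wu)) //.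
    by rewrite leq_mul // leq_pexp2l.
  apply: (at_most_sub (at_most_rep (D := 1) _ dZ td)) => // x [_ xd].
  by rewrite mul1r -sqnE xd.
have box_side := at_most_pair (@at_most_box m) Hside.
apply: (at_most_fiber box_side
  (f := fun t : (int * int) * (int * int) * (int * int) => (t.1.1, t.1.2 - t.1.1))).
- move=> [[a b] c] /= [ba bb bc abc E]; split=> //; split; first exact: in_boxB.
  have u0 := sqn_gt0l abc; split=> //.
    by rewrite (leq_trans (sqn_le (in_boxB bb ba))) // expnMn leq_mul.
  exists (sqn (c - b)), (sqn (a - c)); split=> //.
    apply: (@sqn_gt0l _ (b - a)) => E'; apply: abc; move: E'; rewrite /cross /=; lia.
  apply: (@sqn_gt0l _ (b - a)) => E'; apply: abc; move: E'; rewrite /cross /=; lia.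
move=> [a u].
have [wu|nwu] := pselect (within m u); last first.
  apply: at_most_base => -[[a' b] c] /= [[ba bb bc _ _] [aE uE]].
  by case: nwu; rewrite -uE; exact: in_boxB.
apply: (at_most_inj (@at_most_ellipse R m M (p - sqrtn R (sqn u)) u tauM wu)
  (f := fun t : (int * int) * (int * int) * (int * int) => t.2 - t.1.1)).
- move=> [[a' b] c] /= [[ba bb bc abc E] [aE uE]].
  have cb : c - a' - u = c - b by rewrite -uE; ring.
  split; rewrite ?cb -?uE //; try exact: in_boxB.
  by rewrite -E -(sqnN (a' - c)) opprB; ring.
move=> [[a1 b1] c1] [[a2 b2] c2] /= [_ [a1E u1E]] [_ [a2E u2E]].
move: u1E; rewrite -u2E a1E -a2E => /addIr -> /addIr -> //.
Qed.

Definition int_point (R : realType) (a : int * int) : R * R := (a.1%:~R, a.2%:~R).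

Lemma euclidean_dist_int (R : realType) a b :
  euclidean_dist (int_point R a) (int_point R b) = sqrtn R (sqn (b - a)).
Proof.
rewrite /euclidean_dist /sqrtn pmulrn sqnE /= rmorphD !rmorphXn /= !intrB.
by congr Num.sqrt; ring.
Qed.

Lemma collinear_int (R : realType) a b c :
  cross (b - a) (c - a) = 0 -> collinear (int_point R a) (int_point R b) (int_point R c).
Proof.
case: a b c => [a1 a2] [b1 b2] [c1 c2]; rewrite /cross /= => E.
have E' : (b1%:~R - a1%:~R) * (c2%:~R - a2%:~R) = (b2%:~R - a2%:~R) * (c1%:~R - a1%:~R) :> R.
  by rewrite -!intrB -!intrM; congr _%:~R; lia.
(* The line joins [a] to a vertex distinct from it; if all coincide, the vertical line through [a]
   serves. *)
have [bE|bn] := boolP ((b1 == a1) && (b2 == a2)); last first.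
  exists (b2 - a2)%:~R, (a1 - b1)%:~R, ((b2 - a2)%:~R * a1%:~R + (a1 - b1)%:~R * a2%:~R).
  split; first by move: bn; rewrite !intr_eq0; lia.
  move=> q; rewrite !inE => /orP[/orP[]|] /eqP -> /=; rewrite ?intrB //; nra.
have [cE|cn] := boolP ((c1 == a1) && (c2 == a2)); last first.
  exists (c2 - a2)%:~R, (a1 - c1)%:~R, ((c2 - a2)%:~R * a1%:~R + (a1 - c1)%:~R * a2%:~R).
  split; first by move: cn; rewrite !intr_eq0; lia.
  move=> q; rewrite !inE => /orP[/orP[]|] /eqP -> /=; rewrite ?intrB //; nra.
move: bE cE => /andP[/eqP -> /eqP ->] /andP[/eqP -> /eqP ->].
exists 1, 0, a1%:~R; rewrite oner_eq0; split=> // q; rewrite !inE !orbb => /eqP -> /=.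
by rewrite mul1r mul0r addr0.
Qed.

Lemma grid_int (R : realType) n q : q \in grid R n ->
  exists2 a, in_box (grid_side R n) a & q = int_point R a.
Proof.
case/imfset2P => i /= im [j jm ->]; exists (i%:Z, j%:Z) => //.
by move: im jm; rewrite !mem_iota; split=> /=; lia.
Qed.

Lemma triangle_count_le (R : realType) (n M : nat) (p : R) :
  (forall N, 0 < N <= 1024 * grid_side R n ^ 8 -> tau N <= M)%N ->
  let m := grid_side R n in
  (triangle_count n p <= m * m * (3 * (2 * m).+1 * (20 * M ^ 2)) * (40 * M ^ 2))%N.
Proof.
move=> tauM /=; rewrite /triangle_count.
have main : at_most (fun T => T \in fpowerset (grid R n) /\ nondeg_triangle_of_perimeter p T)
    (grid_side R n * grid_side R n * (3 * (2 * grid_side R n).+1 * (20 * M ^ 2)) * (40 * M ^ 2)).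
  pose g (t : (int * int) * (int * int) * (int * int)) : {fset R * R} :=
    [fset int_point R t.1.1; int_point R t.1.2; int_point R t.2]%fset.
  apply: (at_most_image (g := g) (@at_most_int_triangle R _ M p tauM)) => T [+ [q1 [q2 [q3 [TE]]]]].
  rewrite fpowersetE => /fsubsetP sub.
  have inT q : q \in [fset q1; q2; q3]%fset -> q \in grid R n.
    by rewrite -TE; exact: sub.
  have [|a ba aE] := @grid_int R n q1; first by apply: inT; rewrite !inE eqxx.
  have [|b bb bE] := @grid_int R n q2; first by apply: inT; rewrite !inE eqxx ?orbT.
  have [|c bc cE] := @grid_int R n q3; first by apply: inT; rewrite !inE eqxx ?orbT.
  rewrite aE bE cE !euclidean_dist_int => ncol pE.
  exists (a, b, c); last by rewrite TE aE bE cE.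
  by split=> // E; apply: ncol; exact: collinear_int.
apply: main; first exact: fset_uniq.
by move=> T; rewrite !inE => /andP[-> /asboolP].
Qed.

(** * The divisor bound *)

(** With [g = gcd(d, B)], the cofactor [d / g] is coprime to [B / g] and hence divides [A]. *)
Lemma tauM_le A B : (0 < A)%N -> (0 < B)%N -> (tau (A * B) <= tau A * tau B)%N.
Proof.
move=> A0 B0; have AB0 : (0 < A * B)%N by rewrite muln_gt0 A0.
have H : at_most (fun d => d %| A * B)%N (tau A * tau B).
  apply: (at_most_inj (at_most_pair (at_most_dvdn A0) (at_most_dvdn B0))
    (f := fun d => (d %/ gcdn d B, gcdn d B)%N)).
  - move=> d dAB; split=> /=; last exact: dvdn_gcdr.
    have g0 : (0 < gcdn d B)%N by rewrite gcdn_gt0 B0 orbT.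
    have cop : coprime (d %/ gcdn d B) (B %/ gcdn d B).
      by rewrite /coprime -(@eqn_pmul2r (gcdn d B)) // muln_gcdl !divnK ?mul1n ?dvdn_gcdl ?dvdn_gcdr.
    rewrite -(Gauss_dvdl _ cop) -(@dvdn_pmul2r (gcdn d B)) // -mulnA !divnK ?dvdn_gcdl ?dvdn_gcdr //.
  - move=> d d' _ _ [E1 E2].
    by rewrite -(divnK (dvdn_gcdl d B)) E1 E2 divnK // dvdn_gcdl.
apply: (H (divisors _)); first exact: divisors_uniq.
by move=> d; rewrite -dvdn_divisors.
Qed.

Lemma tau_pfactor p e : prime p -> (tau (p ^ e) <= e.+1)%N.
Proof.
move=> pp.
have H : at_most (fun d => d %| p ^ e)%N e.+1.
  apply: (at_most_image (@at_most_leq e) (g := fun i => (p ^ i)%N)) => d.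
  by move=> /(dvdn_pfactor _ _ pp)[i ie ->]; exists i.
apply: (H (divisors _)); first exact: divisors_uniq.
by move=> d; rewrite -dvdn_divisors // expn_gt0 prime_gt0.
Qed.

(* Prime powers below P are bounded individually; the prime divisors that are
   at least P, counted with multiplicity, number at most log_P N. *)
Lemma tau_le (N P : nat) : (0 < N)%N ->
  exists2 t, (P ^ t <= N)%N & (tau N <= (trunc_log 2 N).+1 ^ P * 2 ^ t)%N.
Proof.
move=> N0; set L := trunc_log 2 N.
have eL p e : prime p -> (p ^ e %| N)%N -> (e <= L)%N.
  move=> pp peN; apply: trunc_log_max => //.
  apply: leq_trans (dvdn_leq N0 peN).
  by case: e {peN} => // e; rewrite leq_exp2r ?prime_gt1.
have main s : all prime s -> {in s, forall p, logn p N <= L}%N ->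
  let X := (\prod_(p <- s) p ^ logn p N)%N in
  exists t, [/\ (0 < X)%N, (P ^ t <= X)%N &
    (tau X <= L.+1 ^ (count (fun p => p < P)%N s) * 2 ^ t)%N].
  elim: s => [|p s IH] /= sp sL; first by exists 0%N; rewrite big_nil.
  have {sp} [pp sp] := andP sp.
  have [|t [X0 t1 t2]] := IH sp.
    by move=> q qs; apply: sL; rewrite inE qs orbT.
  rewrite big_cons; set X := (\prod_(q <- s) _)%N in X0 t1 t2 *.
  set e := logn p N; have eL' : (e <= L)%N by apply: sL; rewrite mem_head.
  have pe0 : (0 < p ^ e)%N by rewrite expn_gt0 prime_gt0.
  have tauX : (tau (p ^ e * X) <= e.+1 * tau X)%N.
    by apply: leq_trans (tauM_le pe0 X0) _; rewrite leq_mul2r tau_pfactor ?orbT.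
  (* A prime below [P] costs a factor [L + 1]; a larger one raises [t] by its multiplicity [e], as
     [e + 1 <= 2 ^ e]. *)
  have [pP|Pp] := ltnP p P.
    exists t; rewrite muln_gt0 pe0 X0; split=> //; first by rewrite (leq_trans t1) ?leq_pmull.
    apply: leq_trans tauX _; rewrite add1n expnS -mulnA.
    by apply: leq_mul => //; rewrite ltnS.
  exists (e + t)%N; rewrite muln_gt0 pe0 X0; split=> //.
    rewrite expnD leq_mul //; case: (e) => // e'; by rewrite leq_exp2r.
  apply: leq_trans tauX _; rewrite add0n expnD mulnCA leq_mul //.
  exact: ltn_expl.
have primesL : {in primes N, forall p, logn p N <= L}%N.
  move=> p; rewrite mem_primes => /and3P[pp _ _].
  exact: eL pp (pfactor_dvdnn p N).
have [|t [_ t1 t2]] := main (primes N) _ primesL.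
  by apply/allP => p; rewrite mem_primes => /and3P[].
have NE : (\prod_(p <- primes N) p ^ logn p N)%N = N.
  by rewrite [RHS]prod_prime_decomp // prime_decompE big_map.
rewrite NE in t1 t2; exists t => //; apply: leq_trans t2 _.
rewrite leq_mul2r leq_pexp2l ?orbT // -size_filter -{2}(size_iota 0 P).
apply: uniq_leq_size; first by rewrite filter_uniq ?primes_uniq.
by move=> p; rewrite mem_filter mem_iota => /andP[].
Qed.

Lemma half_le_ln2 (R : realType) : 2^-1 <= ln 2 :> R.
Proof.
have := @le_ln1Dx R (- 2^-1); rewrite (_ : 1 + - 2^-1 = 2^-1); last by lra.
by rewrite lnV ?posrE //; lra.
Qed.

Lemma expn_le_ln (R : realType) (a t N : nat) : (0 < a)%N -> (a ^ t <= N)%N ->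
  t%:R * ln (a%:R : R) <= ln N%:R.
Proof.
move=> a0 atN; have at0 : (0 < a ^ t)%N by rewrite expn_gt0 a0.
rewrite mulr_natl -lnXn ?ltr0n // -natrX ler_ln ?posrE ?ltr0n ?ler_nat //.
exact: leq_trans atN.
Qed.

(** Take [P] just above [sqrt L] in [tau_le]. In units of [L / ln L], the small primes contribute at
    most 64 to the exponent and the large ones at most 10. *)
Lemma tau_subpoly (R : realType) (L : R) (N : nat) :
  11 <= L -> (0 < N)%N -> ln (N%:R : R) <= 5 * L ->
  (tau N)%:R <= expR (74 * (L / ln L)).
Proof.
move=> L11 N0 NL; have L0 : 0 < L by lra.
(* With the fourth root, [ln L = 4 * l] and [l <= s], so the small-prime exponent [16 * l * s^2]
   times [ln L] is at most [64 * s^4 = 64 * L]. *)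
pose s := Num.sqrt (Num.sqrt L).
have s4 : s ^+ 4 = L.
  by rewrite -[4%N]/(2 * 2)%N exprM !sqr_sqrtr ?sqrtr_ge0 // ltW.
have s0 : 0 < s by rewrite !sqrtr_gt0.
have s1 : 1 < s.
  rewrite ltNge; apply/negP => s1.
  have : s ^+ 4 <= 1 by rewrite exprn_ile1 // ltW.
  by rewrite s4; lra.
pose l := ln s; have l0 : 0 < l by rewrite ln_gt0.
have ls : l <= s by rewrite ltW // ln_sublinear.
have lL : ln L = 4 * l by rewrite -s4 lnXn // mulr_natl.
have /andP[P1 P2] := truncn_itv (sqr_ge0 s); set P := (Num.truncn (s ^+ 2)).+1 in P2.
have s2 : 1 < s ^+ 2 by rewrite exprn_egt1.
have {P1} P1 : P%:R <= 2 * s ^+ 2 by rewrite /P -natr1; lra.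
have [t t1 t2] := tau_le P N0.
have tl : t%:R * (2 * l) <= 5 * s ^+ 4.
  rewrite s4; apply: le_trans NL; apply: le_trans (expn_le_ln R _ t1) => //.
  apply: ler_wpM2l => //; rewrite (_ : 2 * l = ln (s ^+ 2)).
    by rewrite ler_ln ?posrE ?exprn_gt0 ?ltr0n // ltW.
  by rewrite lnXn // mulr_natl.
have Tl : (trunc_log 2 N)%:R <= 10 * L.
  have := @expn_le_ln R 2 (trunc_log 2 N) N isT (@trunc_logP 2 N isT N0).
  have := half_le_ln2 R; have : 0 <= (trunc_log 2 N)%:R :> R by [].
  by move: NL; nra.
have T1 : (trunc_log 2 N).+1%:R <= expR (8 * l).
  rewrite (_ : 8 * l = ln (L ^+ 2)); last by rewrite lnXn // lL; lra.
  (* [10 * L + 1 <= L ^+ 2] holds since [11 <= L]. *)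
  by rewrite lnK ?posrE ?exprn_gt0 // -natr1; nra.
apply: (@le_trans _ _ (expR (8 * l) ^+ P * expR 1 ^+ t)).
  apply: (@le_trans _ _ ((trunc_log 2 N).+1 ^ P * 2 ^ t)%:R); first by rewrite ler_nat.
  rewrite natrM !natrX; apply: ler_pM; rewrite ?exprn_ge0 ?ler0n //.
    by apply: lerXn2r; rewrite ?nnegrE ?expR_ge0.
  apply: lerXn2r; rewrite ?nnegrE ?expR_ge0 //.
  by have := expR_ge1Dx (1 : R); lra.
rewrite -!expRM_natr -expRD ler_expR mul1r lL -s4 mulrA ler_pdivlMr ?mulr_gt0 //.
have e1 : s ^+ 4 = s ^+ 2 * s ^+ 2 by rewrite -exprD.
have h1 : 8 * l * P%:R <= 16 * (l * s ^+ 2) by nra.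
have h2 : l ^+ 2 <= s ^+ 2 by apply: lerXn2r; rewrite ?nnegrE ?(ltW l0) ?(ltW s0).
have h3 : l ^+ 2 * s ^+ 2 <= s ^+ 4 by rewrite e1 ler_wpM2r ?sqr_ge0.
have h4 : 8 * l * P%:R * (4 * l) <= 64 * (l ^+ 2 * s ^+ 2).
  rewrite (_ : 64 * _ = 16 * (l * s ^+ 2) * (4 * l)); last by ring.
  by apply: ler_wpM2r h1; lra.
by rewrite mulrDl; lra.
Qed.

(** * The maximum and its upper bound *)

Lemma max_triangles_le (R : realType) (n B : nat) :
  (forall p : R, triangle_count n p <= B)%N -> (max_triangles R n <= B)%N.
Proof.
by move=> H; rewrite /max_triangles; case: ex_maxnP => _ /asboolP[p _ <-].
Qed.

Lemma triangle_count_le_max (R : realType) (n : nat) (p : R) :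
  0 < p -> (triangle_count n p <= max_triangles R n)%N.
Proof.
move=> p0; rewrite /max_triangles; case: ex_maxnP => k _; apply.
by apply/asboolP; exists p.
Qed.

Lemma grid_side_itv (R : realType) (n : nat) :
  ((grid_side R n) ^ 2 <= n < (grid_side R n).+1 ^ 2)%N.
Proof.
have /andP[h1 h2] := truncn_itv (sqrtr_ge0 (n%:R : R)); rewrite -/(grid_side R n) in h1 h2.
rewrite -(ler_nat R) -(ltr_nat R) !natrX -(sqr_sqrtr (ler0n R n)).
by rewrite ler_pXn2r ?ltr_pXn2r ?nnegrE ?sqrtr_ge0 // h1 h2.
Qed.

(** [7200 = 9 * 20 * 40], using [3 * (2 * m + 1) <= 9 * m]. [296 = 4 * 74], because the divisor
    bound [M] enters to the fourth power. *)
Lemma max_triangles_upper (R : realType) (n : nat) :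
  (1024 <= n)%N -> 11 <= ln (n%:R : R) ->
  (max_triangles R n)%:R <= 7200 * n%:R `^ (3 / 2 + 296 / ln (ln n%:R)) :> R.
Proof.
move=> n1024 L11; set L := ln n%:R in L11 *; set m := grid_side R n.
have nN : (0 < n)%N by lia.
have n0 : 0 < n%:R :> R by rewrite ltr0n.
pose E : R := expR (74 * (L / ln L)); have E0 : 0 <= E := expR_ge0 _.
pose M := Num.truncn E; have ME : M%:R <= E by rewrite truncn_le.
have /andP[mn _] := grid_side_itv R n; rewrite -/m in mn.
have tauM N : (0 < N <= 1024 * m ^ 8)%N -> (tau N <= M)%N.
  move=> /andP[N0 NX]; rewrite truncn_ge_nat //; apply: tau_subpoly => //.
  (* [1024 <= n] and [m^2 <= n] turn [1024 * m^8] into at most [n^5], the source of [5 * L]. *)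
  have Nn : (N <= n ^ 5)%N.
    apply: (leq_trans NX); rewrite (expnS n 4) leq_mul // -[8%N]/(2 * 4)%N expnM.
    by rewrite leq_exp2r.
  rewrite [5 * L]mulr_natl -lnXn // ler_ln ?posrE ?exprn_gt0 ?ltr0n //.
  by rewrite -natrX ler_nat.
have := max_triangles_le (fun p => triangle_count_le p tauM); rewrite -/m => H.
have {H} H : (max_triangles R n <= 7200 * m ^ 3 * M ^ 4)%N.
  apply: (leq_trans H).
  have [->|m0] := posnP m; first by rewrite !mul0n.
  rewrite (_ : 7200 * m ^ 3 * M ^ 4 = m * m * (9 * m * (20 * M ^ 2)) * (40 * M ^ 2))%N.
    have m9 : (3 * (2 * m).+1 <= 9 * m)%N by lia.
    by rewrite leq_mul2r leq_mul2l leq_mul2r m9 !orbT.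
  by rewrite !expnS expn0; ring.
apply: (@le_trans _ _ (7200 * m ^ 3 * M ^ 4)%:R); first by rewrite ler_nat.
rewrite natrM natrM -mulrA ler_wpM2l // powRD ?(gt_eqF n0) ?implybT //.
apply: ler_pM; rewrite ?ler0n //.
  rewrite mulrC powRrM powR12_sqrt ?ler0n // powR_mulrn ?sqrtr_ge0 // natrX.
  apply: lerXn2r; rewrite ?nnegrE ?sqrtr_ge0 //.
  by rewrite /m /grid_side truncn_le sqrtr_ge0.
rewrite natrX (_ : _ `^ _ = E ^+ 4); first by apply: lerXn2r; rewrite ?nnegrE.
rewrite /powR gt_eqF // -expRM_natr -/L; congr expR.
by rewrite [RHS]mulrC mulrA mulrA; ring.
Qed.

(** * Isosceles triangles and the lower bound *)

Definition nat_point (R : realType) (x y : nat) : R * R := (x%:R, y%:R).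

Lemma nat_point_inj (R : realType) (x y x' y' : nat) :
  (nat_point R x y == nat_point R x' y') = (x == x') && (y == y').
Proof. by rewrite xpair_eqE !eqr_nat. Qed.

(* Apex height 2 r i over the base 2 (r^2 - i^2): the legs have length r^2 + i^2,
   hence the perimeter 4 r^2 does not depend on i. *)
Definition isosceles (R : realType) (r : nat) (t : nat * nat * nat) : {fset R * R} :=
  let: (x, y, i) := t in
  [fset nat_point R x y; nat_point R (x + 2 * (r ^ 2 - i ^ 2)) y;
        nat_point R (x + (r ^ 2 - i ^ 2)) (y + 2 * r * i)]%fset.

(** Half the base, the height and the leg form the Pythagorean triple [r^2 - i^2], [2 r i],
    [r^2 + i^2]. *)
Lemma isosceles_nondeg (R : realType) (r x y i : nat) : (0 < i < r)%N ->
  nondeg_triangle_of_perimeter (4 * r%:R ^+ 2 : R) (isosceles R r (x, y, i)).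
Proof.
move=> /andP[i0 ir].
have ir2 : (i ^ 2 < r ^ 2)%N by rewrite ltn_exp2r.
have b0 : 0 < (r ^ 2 - i ^ 2)%:R :> R by rewrite ltr0n subn_gt0.
have h0 : 0 < (2 * r * i)%:R :> R by rewrite ltr0n !muln_gt0 i0 (ltn_trans i0 ir).
have bE : (r ^ 2 - i ^ 2)%:R = r%:R ^+ 2 - i%:R ^+ 2 :> R by rewrite natrB ?(ltnW ir2) // !natrX.
have hE : (2 * r * i)%:R = 2 * r%:R * i%:R :> R by rewrite !natrM.
have xE : (x + 2 * (r ^ 2 - i ^ 2))%:R = x%:R + 2 * (r ^ 2 - i ^ 2)%:R :> R.
  by rewrite natrD natrM.
exists (nat_point R x y), (nat_point R (x + 2 * (r ^ 2 - i ^ 2)) y),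
  (nat_point R (x + (r ^ 2 - i ^ 2)) (y + 2 * r * i)); split=> //.
  move=> [u [v [w [uv E]]]].
  have /= E1 := E (nat_point R x y) _.
  have /= E2 := E (nat_point R (x + 2 * (r ^ 2 - i ^ 2)) y) _.
  have /= E3 := E (nat_point R (x + (r ^ 2 - i ^ 2)) (y + 2 * r * i)) _.
  move: E1 E2 E3; rewrite !inE !eqxx !orbT => /(_ isT) E1 /(_ isT) + /(_ isT).
  rewrite xE !natrD -E1 => E2 E3.
  have u0 : u = 0.
    have : u * (r ^ 2 - i ^ 2)%:R = 0 by lra.
    by move/eqP; rewrite mulf_eq0 (gt_eqF b0) orbF => /eqP.
  have v0 : v = 0.
    have : v * (2 * r * i)%:R = 0 by move: E3; rewrite u0; lra.
    by move/eqP; rewrite mulf_eq0 (gt_eqF h0) orbF => /eqP.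
  by move: uv; rewrite u0 v0 eqxx.
have sq (z w : R) : 0 <= w -> z = w ^+ 2 -> Num.sqrt z = w.
  by move=> w0 ->; rewrite sqrtr_sqr ger0_norm.
rewrite /euclidean_dist /= xE !natrD.
rewrite (sq _ (2 * (r ^ 2 - i ^ 2)%:R)); [|lra|by ring].
rewrite (sq _ (r%:R ^+ 2 + i%:R ^+ 2)); [|by rewrite addr_ge0 ?sqr_ge0|by rewrite bE hE; ring].
rewrite (sq _ (r%:R ^+ 2 + i%:R ^+ 2)); [|by rewrite addr_ge0 ?sqr_ge0|by rewrite bE hE; ring].
by rewrite bE; ring.
Qed.

Lemma nat_point_grid (R : realType) (n x y : nat) :
  (0 < x <= grid_side R n)%N -> (0 < y <= grid_side R n)%N ->
  nat_point R x y \in grid R n.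
Proof.
move=> xm ym; apply/imfset2P; exists x; first by rewrite /= mem_iota; lia.
by exists y => //=; rewrite mem_iota; lia.
Qed.

Lemma isosceles_inj (R : realType) (r : nat) (x y i x' y' i' : nat) :
  (0 < i < r)%N -> (0 < i' < r)%N ->
  isosceles R r (x, y, i) = isosceles R r (x', y', i') -> (x, y, i) = (x', y', i').
Proof.
move=> /andP[i0 ir] /andP[i0' ir'] E.
have b0 : (i ^ 2 < r ^ 2)%N by rewrite ltn_exp2r.
have b0' : (i' ^ 2 < r ^ 2)%N by rewrite ltn_exp2r.
have h0 : (0 < 2 * r * i)%N by rewrite !muln_gt0 i0 (ltn_trans i0 ir).
have h0' : (0 < 2 * r * i')%N by rewrite !muln_gt0 i0' (ltn_trans i0 ir).
have inE1 x1 y1 : (nat_point R x1 y1 \in isosceles R r (x, y, i)) =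
    (nat_point R x1 y1 \in isosceles R r (x', y', i')) by rewrite E.
have A := inE1 x y; have B := inE1 (x + 2 * (r ^ 2 - i ^ 2))%N y.
have C := inE1 (x + (r ^ 2 - i ^ 2))%N (y + 2 * r * i)%N.
have A' := inE1 x' y'; have B' := inE1 (x' + 2 * (r ^ 2 - i' ^ 2))%N y'.
have C' := inE1 (x' + (r ^ 2 - i' ^ 2))%N (y' + 2 * r * i')%N.
(* Testing each of the six vertices for membership in the other triangle reduces set equality to
   linear conditions on coordinates, half-bases and heights. *)
move: A B C A' B' C'; rewrite !inE !nat_point_inj !eqxx ?orbT {E inE1}.
set b := (r ^ 2 - i ^ 2)%N; set b' := (r ^ 2 - i' ^ 2)%N.
have {b0} b0 : (0 < b)%N by rewrite /b; lia.
have {b0'} b0' : (0 < b')%N by rewrite /b'; lia.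
move=> A B C A' B' C'.
have : [/\ x = x', y = y' & 2 * r * i = 2 * r * i']%N.
  move: h0 h0' A B C A' B' C'; set h := (2 * r * i)%N; set h' := (2 * r * i')%N.
  clearbody h h' b b'; clear -b0 b0'.
  move=> h0 h0' A B C A' B' C'; have yy : y = y' by lia.
  have hh : h = h' by lia.
  by split; lia.
case=> -> -> /eqP; rewrite eqn_pmul2l ?muln_gt0 ?(ltn_trans i0 ir) //.
by move=> /eqP ->.
Qed.

(** Width and height are at most [2 * r ^ 2], so every translate whose lower left vertex lies in a
    square of side [2 * r ^ 2] fits into the grid. *)
Lemma triangle_count_ge (R : realType) (n r : nat) : (4 * r ^ 2 <= grid_side R n)%N ->
  (2 * r ^ 2 * (2 * r ^ 2) * r.-1 <= triangle_count n (4 * r%:R ^+ 2 : R))%N.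
Proof.
move=> rm; set A := (2 * r ^ 2)%N.
pose s := [seq (xy, i) | xy <- [seq (x, y) | x <- iota 1 A, y <- iota 1 A], i <- iota 1 r.-1].
have sP x y i : (x, y, i) \in s -> [/\ (0 < x <= A)%N, (0 < y <= A)%N & (0 < i < r)%N].
  case/allpairsP => -[[x1 y1] i1] /= [/allpairsP[[x2 y2] /= [+ + [-> ->]]] + [-> -> ->]].
  by rewrite !mem_iota => *; split; lia.
have us : uniq s.
  apply: allpairs_uniq; rewrite ?iota_uniq //; last by move=> [? ?] [? ?] _ _ [-> ->].
  by apply: allpairs_uniq; rewrite ?iota_uniq // => -[? ?] [? ?] _ _ [-> ->].
have -> : (A * A * r.-1)%N = size (map (isosceles R r) s).
  by rewrite size_map !size_allpairs !size_iota.
apply: uniq_leq_size.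
  rewrite map_inj_in_uniq // => -[[x y] i] [[x' y'] i'] /sP[_ _ ii] /sP[_ _ ii'].
  exact: isosceles_inj.
move=> T /mapP[[[x y] i] /sP[xA yA ir] ->].
rewrite !inE; apply/andP; split; last exact/asboolP/isosceles_nondeg.
have h : (2 * r * i <= A)%N.
  have /andP[_ /ltnW ir'] := ir.
  by rewrite /A -mulnn -mulnA leq_mul2l /= leq_mul2l ir' orbT.
have b : (r ^ 2 - i ^ 2 <= r ^ 2)%N by exact: leq_subr.
have {rm} rm : (2 * A <= grid_side R n)%N by rewrite /A; lia.
have AE : A = (2 * r ^ 2)%N by [].
rewrite fpowersetE; apply/fsubsetP => q.
by rewrite !inE => /orP[/orP[]|] /eqP ->; apply: nat_point_grid; lia.
Qed.

Lemma max_triangles_lower (R : realType) (n : nat) : (256 <= n)%N ->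
  512^-1 * n%:R `^ (5 / 4) <= (max_triangles R n)%:R :> R.
Proof.
move=> n256; set m := grid_side R n.
have /andP[_ nm] := grid_side_itv R n; rewrite -/m in nm.
have m16 : (16 <= m)%N.
  have : (16 ^ 2 < m.+1 ^ 2)%N by apply: leq_ltn_trans nm.
  by rewrite ltn_exp2r.
(* The largest [r] with [4 * r ^ 2 <= m]; [256 <= n] ensures [r >= 2]. *)
have [r /andP[rm mr]] := exists_nat_sqrt (m %/ 4).
have r2 : (2 <= r)%N.
  have : (2 ^ 2 < r.+1 ^ 2)%N by apply: leq_ltn_trans mr; rewrite leq_divRL.
  by rewrite ltn_exp2r.
have rm4 : (4 * r ^ 2 <= m)%N by rewrite mulnC -leq_divRL.
have mr4 : (m.+1 <= 4 * r.+1 ^ 2)%N by rewrite mulnC -ltn_divLR.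
have count := triangle_count_ge rm4.
have p0 : 0 < 4 * r%:R ^+ 2 :> R by rewrite mulr_gt0 // exprn_gt0 // ltr0n; lia.
have {count} count := leq_trans count (triangle_count_le_max n p0).
have n_le : n%:R <= (2 * r.+1%:R) ^+ 4 :> R.
  have -> : (2 * r.+1%:R) ^+ 4 = ((4 * r.+1 ^ 2) ^ 2)%:R :> R.
    by rewrite natrX natrM natrX; ring.
  by rewrite ler_nat ltnW // (leq_trans nm) // leq_exp2r.
have r1 : (2 * r.+1%:R) <= 4 * r%:R :> R.
  by rewrite -[4]/(2 * 2)%:R -natrM -natrM ler_nat; lia.
have r0 : 0 <= 2 * r.+1%:R :> R by rewrite mulr_ge0.
have pow : n%:R `^ (5 / 4) <= (4 * r%:R) ^+ 5 :> R.
  apply: (@le_trans _ _ (((2 * r.+1%:R) ^+ 4) `^ (5 / 4))).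
    by apply: ge0_ler_powR; rewrite ?nnegrE ?ler0n ?exprn_ge0 //; lra.
  rewrite -(powR_mulrn 4) // -powRrM (_ : 4%:R * (5 / 4) = 5%:R); last by lra.
  by rewrite powR_mulrn //; apply: lerXn2r; rewrite ?nnegrE // mulr_ge0.
(* [n^(5/4) <= 4^5 * r^5 = 512 * (2 * r^5)], and [r <= 2 * (r - 1)] gives
   [2 * r^5 <= 4 * r^4 * (r - 1)]. *)
apply: (@le_trans _ _ (2 * r ^ 5)%:R).
  rewrite natrM natrX.
  have : (4 * r%:R) ^+ 5 = 1024 * r%:R ^+ 5 :> R by ring.
  by move: pow => /[swap] ->; lra.
rewrite ler_nat; apply: leq_trans count.
have : (r <= 2 * r.-1)%N by lia.
move: (r.-1) => k rk; rewrite !expnS expn0; nia.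
Qed.

Theorem theorem2 (R : realType) :
  exists C C' c : R, [/\ 0 < C, 0 < C', 0 < c,
    \forall n \near \oo,
      (max_triangles R n)%:R <= C * n%:R `^ (3 / 2 + C' / ln (ln n%:R)) &
    \forall n \near \oo,
      c * n%:R `^ (5 / 4) <= (max_triangles R n)%:R].
Proof.
exists 7200, 296, 512^-1; split.
- by rewrite ltr0n.
- by rewrite ltr0n.
- by rewrite invr_gt0 ltr0n.
- near=> n; apply: max_triangles_upper; first by near: n; exact: nbhs_infty_ge.
  have n1 : expR 11 <= n%:R :> R by near: n; exact: nbhs_infty_ger.
  by rewrite -[leLHS]expRK ler_ln ?posrE ?expR_gt0 // (lt_le_trans _ n1) ?expR_gt0.
- by near=> n; apply: max_triangles_lower; near: n; exact: nbhs_infty_ge.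
Unshelve. all: by end_near. Qed.
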